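(* Let $k\geq 4$ and $p\geq 2$ be integers. There is $n_0(k)$ such that for all $n>n_0(k)$: the graph $H(n,k)$ contains no copy of $P_k$, $t_p(n,P_k)=e_p(H(n,k))$, and $H(n,k)$ is the unique $n$-vertex $P_k$-free graph $G$ with $e_p(G)=t_p(n,P_k)$ (up to isomorphism).
   Context: All graphs are finite, simple, undirected. For a graph $G$ with degree sequence $d_1,\ldots,d_n$ and a positive integer $p$, $e_p(G)=\sum_{i=1}^n d_i^p$. For a fixed graph $H$, $t_p(n,H)$ is the maximum of $e_p(G)$ over all $n$-vertex graphs $G$ not containing $H$ as a subgraph. $P_k$ denotes the path with $k$ vertices. For $n\geq k\geq 4$, the graph $H(n,k)$ has vertex set $A\cup B$ (disjoint) with $|B|=\lfloor k/2\rfloor-1$ and $|A|=n-|B|$; $B$ induces a complete graph; $A$ induces an independent set when $k$ is even, and induces a single edge plus $|A|-2$ isolated vertices when $k$ is odd; and every vertex of $A$ is adjacent to every vertex of $B$. *)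

(* Defs.v *)
From HB Require Import structures.
From mathcomp Require Import all_boot.

Set Implicit Arguments.
Unset Strict Implicit.
Unset Printing Implicit Defensive.

(* Adjacency is stored as a finite function so that the graphs on a fixed
   vertex set form a finType, over which t_p can be taken as a \max. *)
Definition simple_adj (T : finType) (a : {ffun T * T -> bool}) : bool :=
  [forall x, forall y, a (x, y) == a (y, x)] && [forall x, ~~ a (x, x)].

Record sgraph (T : finType) := SGraph {
  adj : {ffun T * T -> bool};
  _ : simple_adj adj }.

HB.instance Definition _ (T : finType) := [isSub for @adj T].
HB.instance Definition _ (T : finType) := [Finite of sgraph T by <:].

Definition edge (T : finType) (G : sgraph T) : rel T :=
  fun x y => adj G (x, y).

Lemma simple_adj_rel (T : finType) (e : rel T) :
  symmetric e -> irreflexive e -> simple_adj [ffun u : T * T => e u.1 u.2].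
Proof.
move=> e_sym e_irr; apply/andP; split.
  by apply/forallP=> x; apply/forallP=> y; rewrite !ffunE /= e_sym.
by apply/forallP=> x; rewrite ffunE /= e_irr.
Qed.

Definition sgraph_of (T : finType) (e : rel T)
    (e_sym : symmetric e) (e_irr : irreflexive e) : sgraph T :=
  SGraph (simple_adj_rel e_sym e_irr).

Lemma sgraph_ofE (T : finType) (e : rel T)
    (e_sym : symmetric e) (e_irr : irreflexive e) :
  edge (sgraph_of e_sym e_irr) =2 e.
Proof. by move=> x y; rewrite /edge ffunE. Qed.

Lemma edge_sym (T : finType) (G : sgraph T) : symmetric (edge G).
Proof.
have /andP[/forallP a_sym _] : simple_adj (adj G) by apply: valP.
by move=> x y; apply/eqP; apply: (forallP (a_sym x)).
Qed.

Lemma edge_irr (T : finType) (G : sgraph T) : irreflexive (edge G).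
Proof.
have /andP[_ /forallP a_irr] : simple_adj (adj G) by apply: valP.
by move=> x; apply/negbTE/a_irr.
Qed.

Definition degree (T : finType) (G : sgraph T) (x : T) : nat :=
  #|[set y | edge G x y]|.

Definition e_ (p : nat) (T : finType) (G : sgraph T) : nat :=
  \sum_(x : T) degree G x ^ p.

(* G contains H as a (not necessarily induced) subgraph. *)
Definition contains (U T : finType) (H : sgraph U) (G : sgraph T) : bool :=
  [exists f : {ffun U -> T}, injectiveb f &&
    [forall x, forall y, edge H x y ==> edge G (f x) (f y)]].

Definition t_ (p n : nat) (U : finType) (H : sgraph U) : nat :=
  \max_(G : sgraph 'I_n | ~~ contains H G) e_ p G.

Definition isomorphic (T U : finType) (G : sgraph T) (H : sgraph U) : Prop :=
  exists2 f : T -> U, bijective f &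
    forall x y, edge H (f x) (f y) = edge G x y.

Definition path_rel (k : nat) : rel 'I_k :=
  fun i j => (i.+1 == j :> nat) || (j.+1 == i :> nat).

Lemma path_rel_sym k : symmetric (@path_rel k).
Proof. by move=> i j; rewrite /path_rel orbC. Qed.

Lemma path_rel_irr k : irreflexive (@path_rel k).
Proof. by move=> i; rewrite /path_rel orbb gtn_eqF. Qed.

Definition path_graph (k : nat) : sgraph 'I_k :=
  sgraph_of (@path_rel_sym k) (@path_rel_irr k).

(* H(n, k) on 'I_n: B is the set of vertices i < k./2.-1 and A the set of the
   others; when k is odd, the single edge inside A joins the two smallest
   vertices of A. Meaningful for 4 <= k <= n. *)
Definition sizeB (k : nat) : nat := k./2.-1.

Definition inB (n k : nat) (i : 'I_n) : bool := i < sizeB k.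

Definition extra_edge (n k : nat) (i j : 'I_n) : bool :=
  (i == sizeB k :> nat) && (j == (sizeB k).+1 :> nat).

Definition H_rel (n k : nat) : rel 'I_n :=
  fun i j => (i != j) &&
    [|| inB k i, inB k j | odd k && (extra_edge k i j || extra_edge k j i)].

Lemma H_rel_sym n k : symmetric (@H_rel n k).
Proof.
by move=> i j; rewrite /H_rel eq_sym orbCA [extra_edge k i j || _]orbC.
Qed.

Lemma H_rel_irr n k : irreflexive (@H_rel n k).
Proof. by move=> i; rewrite /H_rel eqxx. Qed.

Definition H_graph (n k : nat) : sgraph 'I_n :=
  sgraph_of (@H_rel_sym n k) (@H_rel_irr n k).

(* Main.v *)
Require Import Defs.
From mathcomp Require Import all_boot zify.

Set Implicit Arguments.
Unset Strict Implicit.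
Unset Printing Implicit Defensive.

(* Write b = floor(k/2) - 1, N = n - 1, and let G be P_k-free with
   e_p(G) >= e_p(H(n, k)) >= b N^p. Since d^p <= N^(p-2) d^2, the sum of the
   squared degrees is at least b N^2, which makes everything uniform in p.
   G is degenerate, so only boundedly many vertices have degree linear in n;
   b + 1 of them cannot have b + 2 common neighbours, so their degrees sum to
   at most b n + O(1). By convexity b vertices, forming a set B, have degree
   close to N. Let [joined] be the common neighbourhood of B, [rest] the other
   vertices outside B, and [exits] the vertices of [joined] with a neighbour
   outside B. A path alternating between B and [joined] can be prolonged at both
   ends, whence there are at most two exits, and none if k is even. Each vertex
   of [rest] costs N^(p-1) in the degrees of B, more than it brings back because
   [rest] is sparse too; so [rest] is empty and G is a spanning subgraph
   of H(n, k). *)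

(** * Paths as vertex sequences, and double counting *)

Lemma contains_path (T : finType) (G : sgraph T) (k : nat) (s : seq T) :
  0 < k <= size s -> uniq s -> sorted (edge G) s -> contains (path_graph k) G.
Proof.
move=> /andP[k_gt0 ks] us ss.
have [x0 _] : exists x0, x0 \in s.
  case: s ks {us ss} => [|x s] ks; last by exists x; rewrite mem_head.
  by rewrite leqNgt k_gt0 in ks.
apply/existsP; exists [ffun i : 'I_k => nth x0 s i]; apply/andP; split.
  apply/injectiveP => i j; rewrite !ffunE => /eqP.
  rewrite nth_uniq ?(leq_trans (ltn_ord _) ks) // => /eqP; exact: val_inj.
have stp m : m.+1 < k -> edge G (nth x0 s m) (nth x0 s m.+1).
  by move=> lt_mk; move/(sortedP x0): ss; apply; apply: leq_trans ks.
apply/forallP=> i; apply/forallP=> j; apply/implyP.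
rewrite sgraph_ofE !ffunE => /orP[]/eqP ij.
  by rewrite -ij; apply: stp; rewrite ij.
by rewrite edge_sym -ij; apply: stp; rewrite ij.
Qed.

(** Used with [ws] one longer than [bs], so that the result starts and ends in [ws] and every
    element of [bs] lies between two elements of [ws]. *)
Fixpoint interleave (T : Type) (ws bs : seq T) : seq T :=
  match ws, bs with
  | w :: ws', b :: bs' => w :: b :: interleave ws' bs'
  | _, _ => ws ++ bs
  end.

Lemma perm_interleave (T : eqType) (ws bs : seq T) :
  perm_eq (interleave ws bs) (ws ++ bs).
Proof.
elim: ws bs => [|w ws IH] [|b bs] //=.
by rewrite perm_cons perm_sym -cat1s perm_catCA /= perm_cons perm_sym.
Qed.

(** [behead] removes the start [w], which [path] takes as a separate argument. The last vertex is
    recorded so that the walk can be prolonged there. *)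
Lemma path_interleave (T : eqType) (e : rel T) (w : T) (ws bs : seq T) :
  symmetric e -> size ws = size bs ->
  {in w :: ws & bs, forall x y, e x y} ->
  path e w (behead (interleave (w :: ws) bs))
  /\ last w (behead (interleave (w :: ws) bs)) = last w ws.
Proof.
move=> e_sym; elim: bs w ws => [|b bs IH] w [|w' ws] //= [sz] ewb.
have [|pw lw] := IH w' ws sz.
  by move=> x y xw yb; apply: ewb; rewrite inE ?xw ?yb orbT.
have e1 : e w b by apply: ewb; rewrite mem_head.
have e2 : e b w' by rewrite e_sym ewb // !inE eqxx ?orbT.
by case: bs {IH ewb sz} pw lw => [|b' bs] /= pw lw; rewrite e1 e2 ?pw ?lw.
Qed.

Lemma sum_indicator (T : finType) (S : {set T}) (P : pred T) :
  \sum_(y in S) P y = #|[set y in S | P y]|.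
Proof.
rewrite -sum1_card big_mkcond [RHS]big_mkcond /=.
by apply: eq_bigr => y _; rewrite !inE; case: (y \in S); case: (P y).
Qed.

(** Both sides count the related pairs. The relation is arbitrary because non-edges are counted as
    well as edges. *)
Lemma sum_cards_incidence (T : finType) (e : rel T) (S S' : {set T}) :
  \sum_(x in S) #|[set y in S' | e x y]| = \sum_(y in S') #|[set x in S | e x y]|.
Proof.
under eq_bigr do rewrite -sum_indicator.
by rewrite exchange_big; apply: eq_bigr => y _; rewrite sum_indicator.
Qed.

(** * Long paths, and the sparsity of [P_k]-free graphs *)

Section LongPaths.
Variables (T : finType) (G : sgraph T).

(* The path runs through [rev s], [x], alternates between [bs] and [W], and
   leaves through [x'], [s']. *)
Lemma alternating_path (bs s s' : seq T) (x x' : T) (W : {set T}) :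
  0 < size bs ->
  {in W & bs, forall w b, edge G w b} ->
  x \in W -> x' \in W ->
  path (edge G) x s -> path (edge G) x' s' ->
  uniq bs -> uniq (x :: s ++ x' :: s') ->
  ~~ has (mem bs) (s ++ s') ->
  size bs + (size s + size s').+1 <= #|W| ->
  exists2 q, uniq q & sorted (edge G) q
    /\ size q = (size bs).*2 + (size s + size s').+1.
Proof.
move=> bs0 eWb xW x'W ps ps' ubs us dis szW.
pose U := x :: s ++ x' :: s'.
pose F := [seq y <- enum W | y \notin U].
pose mid := take (size bs).-1 F.
have szF : (size bs).-1 <= size F.
  rewrite size_filter.
  have := count_predC (mem U) (enum W).
  rewrite -cardE.
  have : count (mem U) (enum W) <= size U.
    rewrite -size_filter; apply: uniq_leq_size.
      by rewrite filter_uniq ?enum_uniq.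
    by move=> y; rewrite mem_filter => /andP[].
  rewrite /U /= size_cat /=.
  by rewrite -[count (predC _) _]/(count (fun y => y \notin U) _); lia.
have szmid : size mid = (size bs).-1 by rewrite size_take; case: ltngtP szF.
have umid : uniq mid by apply: take_uniq; apply: filter_uniq; apply: enum_uniq.
have midF y : y \in mid -> y \in W /\ y \notin U.
  by move/mem_take; rewrite mem_filter mem_enum => /andP[].
pose ws := mid ++ [:: x'].
have szws : size ws = size bs by rewrite size_cat szmid /=; lia.
have wsW : {in x :: ws & bs, forall w b, edge G w b}.
  move=> w b; rewrite inE mem_cat mem_seq1 => /or3P[/eqP->|/midF[wW _]|/eqP->] bb;
   exact: eWb.
have [pI lI] := path_interleave (@edge_sym _ G) szws wsW.
have hd : interleave (x :: ws) bs = x :: behead (interleave (x :: ws) bs).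
  by case: (bs).
exists (rev s ++ interleave (x :: ws) bs ++ s').
  have pe : perm_eq (rev s ++ interleave (x :: ws) bs ++ s') (bs ++ mid ++ U).
    apply/permP => P; rewrite !count_cat count_rev (permP (perm_interleave _ _)).
    by rewrite /U /ws /= ?count_cat /= ?count_cat /= ?count_cat /=; lia.
  rewrite (perm_uniq pe) cat_uniq ubs cat_uniq -/U us.
  rewrite umid !andTb andbT; apply/andP; split; apply/hasPn => y.
    have bW z : z \in W -> z \notin bs.
      by move=> zW; apply/negP => /(eWb _ _ zW); rewrite edge_irr.
    rewrite mem_cat => /orP[/midF[]/bW//|].
    rewrite inE mem_cat inE => /or4P[/eqP->|ys|/eqP->|ys];
      try exact: bW; by apply: (hasPn dis); rewrite mem_cat ys ?orbT.
  by move=> yU; apply/negP => /midF[_]; rewrite yU.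
split; last first.
  rewrite !size_cat size_rev (perm_size (perm_interleave _ _)) size_cat /= szws; lia.
rewrite hd; set I := behead _ in pI lI *.
have lx : last x I = x' by rewrite lI last_cat.
rewrite /= -cat_rcons -rev_cons.
have : sorted (edge G) (rev (x :: s)).
  by rewrite rev_sorted /=; apply: sub_path ps => a c; rewrite edge_sym.
rewrite rev_cons.
case E: (rcons (rev s) x) => [|z q] //=; first by case: (rev s) E.
rewrite cat_path => -> /=.
have -> : last z q = x.
  by rewrite -[last z q]/(last z (z :: q)) -E last_rcons.
by rewrite cat_path pI lx.
Qed.

Definition deg_in (S : {set T}) (x : T) := #|[set y in S | edge G x y]|.

(** Greedy extension at the front: as long as the path has fewer than [k] vertices, the first one
    has more neighbours in [S] than there are other vertices on the path. *)
Lemma long_path_min_degree (k : nat) (S : {set T}) (x0 : T) :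
  x0 \in S -> {in S, forall x, k <= (deg_in S x).+1} ->
  forall j, 0 < j <= k ->
  exists (x : T) (s : seq T),
    [/\ uniq (x :: s), path (edge G) x s, {subset x :: s <= S} & (size s).+1 = j].
Proof.
move=> x0S mind; elim=> // -[|j] IH /= jk.
  by exists x0, [::]; split => // y; rewrite inE => /eqP->.
have [|x [s [us ps sS szs]]] := IH; first lia.
have xS : x \in S by apply: sS; rewrite mem_head.
have : ~~ ([set y in S | edge G x y] \subset [set y in s]).
  apply/negP => /subset_leq_card; rewrite [X in _ <= X]cardsE => h1.
  have := leq_trans h1 (card_size s); have := mind x xS; rewrite /deg_in; lia.
case/subsetPn => y; rewrite !inE => /andP[yS exy] ys.
exists y, (x :: s); split.
- apply/andP; split=> //; rewrite inE negb_or ys andbT.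
  by apply/eqP => yx; rewrite yx edge_irr in exy.
- by rewrite /= edge_sym exy.
- by move=> z; rewrite inE => /predU1P[->//|]; apply: sS.
- by rewrite /= szs.
Qed.

Variable k : nat.
Hypothesis k_gt0 : 0 < k.
Hypothesis Pk_free : ~~ contains (path_graph k) G.

Lemma no_long_path (q : seq T) :
  uniq q -> sorted (edge G) q -> k <= size q -> False.
Proof.
move=> uq sq szq; move/negP: Pk_free; apply.
by apply: (@contains_path _ _ _ q); rewrite ?k_gt0.
Qed.

(** Degeneracy: by the greedy path some vertex of [S] has fewer than [k] neighbours in [S]. Removing
    it lowers the sum by twice that number, and induction applies to what is left. *)
Lemma sum_deg_in (S : {set T}) : \sum_(x in S) deg_in S x <= k.*2 * #|S|.
Proof.
have [n] := ubnP #|S|; elim: n => // n IH in S *; rewrite ltnS => leSn.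
have [->|[x0 x0S]] := set_0Vmem S; first by rewrite big_set0.
have [xm xmS degm] : exists2 x, x \in S & deg_in S x < k.
  apply/exists_inP; apply: contraT; rewrite negb_exists_in => /forall_inP mind.
  have mind' : {in S, forall x, k <= (deg_in S x).+1}.
    by move=> x /mind; rewrite -leqNgt => /leqW.
  have [|x [s [us ps _ szs]]] := long_path_min_degree x0S mind' (j := k).
    by rewrite k_gt0 /=.
  by have := @no_long_path (x :: s) us ps; rewrite /= szs leqnn => /(_ isT).
have cS := cardsD1 xm S; rewrite xmS /= in cS.
have IH' : \sum_(x in S :\ xm) deg_in (S :\ xm) x <= k.*2 * #|S :\ xm|.
  by apply: IH; move: leSn; rewrite cS; lia.
rewrite (big_setD1 xm) //=.
have -> : \sum_(x in S :\ xm) deg_in S x =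
  \sum_(x in S :\ xm) deg_in (S :\ xm) x + \sum_(x in S :\ xm) edge G xm x.
  rewrite -big_split /=; apply: eq_bigr => x _.
  rewrite /deg_in (cardsD1 xm) inE xmS /= edge_sym addnC; congr (_ + _).
  by apply: eq_card => y; rewrite !inE andbA.
have -> : \sum_(x in S :\ xm) edge G xm x = deg_in S xm.
  rewrite sum_indicator; apply: eq_card => y; rewrite !inE.
  by case: eqP => [->|_]; rewrite ?edge_irr ?andbF.
rewrite cS; lia.
Qed.

End LongPaths.

(** * Vertices of large degree *)

Section HighDegrees.
Variables (T : finType) (G : sgraph T) (k b : nat).
Hypothesis k_gt0 : 0 < k.
Hypothesis k_le : k <= b.*2 + 3.
Hypothesis Pk_free : ~~ contains (path_graph k) G.

Lemma degree_deg_in x : degree G x = deg_in G [set: T] x.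
Proof. by apply: eq_card => y; rewrite !inE. Qed.

Lemma degree_lt x : degree G x < #|T|.
Proof.
rewrite -cardsT [X in _ < X](cardsD1 x) inE add1n ltnS subset_leq_card //.
by apply/subsetP => y; rewrite !inE andbT; apply: contraTneq => ->; rewrite edge_irr.
Qed.

Lemma sum_degree : \sum_x degree G x <= k.*2 * #|T|.
Proof.
have := sum_deg_in k_gt0 Pk_free [set: T]; rewrite cardsT; apply: leq_trans.
apply: eq_leq; apply: eq_big => [x|x _]; first by rewrite inE.
exact: degree_deg_in.
Qed.

(* [b + 1] vertices with [b + 2] common neighbours carry a path on [2b + 3] vertices. *)
Lemma card_common_type (L A : {set T}) : b < #|A| ->
  #|[set y | [set x in L | edge G x y] == A]| <= b.+1.
Proof.
move=> bA; rewrite leqNgt; apply/negP; set W := [set y | _] => cW.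
pose bs := take b.+1 (enum A).
have szbs : size bs = b.+1.
  by rewrite size_takel // -cardE.
have ubs : uniq bs by rewrite take_uniq ?enum_uniq.
have eWb : {in W & bs, forall w x, edge G w x}.
  move=> w x; rewrite inE => /eqP defA /mem_take; rewrite mem_enum -defA inE edge_sym.
  by case/andP.
have [x [x' [xW x'W xx']]] : exists x x', [/\ x \in W, x' \in W & x != x'].
  by apply/card_gt1P; lia.
have [||||q uq [sq szq]] :=
  alternating_path (s := [::]) (s' := [::]) _ eWb xW x'W isT isT ubs.
- by rewrite szbs.
- by rewrite /= inE xx'.
- by [].
- by rewrite szbs /=; lia.
by apply: (no_long_path k_gt0 Pk_free uq sq); rewrite szq szbs /=; lia.
Qed.

(** Counted from the other side, each [y] contributes the number of its neighbours in [L]. This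
    exceeds [b] only for [y] in [bad], and [card_common_type] leaves at most [b.+1] such [y] for
    each of the [2 ^ #|L|] possible neighbourhoods. *)
Lemma sum_degree_few (L : {set T}) :
  \sum_(x in L) degree G x <= b * #|T| + 2 ^ #|L| * b.+1 * #|L|.
Proof.
pose ty y := [set x in L | edge G x y].
pose bad := [set y | b < #|ty y|].
have cbad : #|bad| <= 2 ^ #|L| * b.+1.
  rewrite -card_powerset -sum1_card.
  rewrite (partition_big ty (mem (powerset L))) /=; last first.
    by move=> y _; rewrite inE; apply/subsetP => x; rewrite inE => /andP[].
  rewrite -sum_nat_const; apply: leq_sum => A _; rewrite sum1_card.
  have [bA|Ab] := ltnP b #|A|.
    apply: leq_trans (card_common_type L bA); apply: subset_leq_card.
    by apply/subsetP => y; rewrite !inE => /andP[].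
  rewrite eq_card0 // => y; apply/negP => /andP[ybad /eqP tyA].
  by move: ybad; rewrite inE tyA ltnNge Ab.
have -> : \sum_(x in L) degree G x = \sum_y #|ty y|.
  transitivity (\sum_(x in L) #|[set y in [set: T] | edge G x y]|).
    by apply: eq_bigr => x _; apply: eq_card => y; rewrite !inE.
  by rewrite sum_cards_incidence; apply: eq_bigl => y; rewrite inE.
apply: (@leq_trans (\sum_y (b + (y \in bad) * #|L|))).
  apply: leq_sum => y _; rewrite inE; case: ltnP => [_|//]; rewrite ?mul1n ?addn0 //.
  apply: leq_trans (leq_addl _ _); apply: subset_leq_card.
  by apply/subsetP => x; rewrite inE => /andP[].
rewrite big_split /= sum_nat_const -big_distrl /= mulnC leq_add2l leq_mul2r.
apply/orP; right; apply: leq_trans cbad; apply: eq_leq.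
by rewrite -sum1_card [RHS]big_mkcond /=; apply: eq_bigr => y _; case: (y \in bad).
Qed.

(* Vertices of degree at least [(1 - 1/m) (n - 1)]. *)
Definition high (m : nat) : {set T} :=
  [set x | m.-1 * #|T|.-1 <= m * degree G x].

(** Chosen so that the vertices of degree below [#|T| / medium_bound m] have squared degrees summing
    to at most [#|T| ^ 2 / (8 * m)]. *)
Definition medium_bound (m : nat) : nat := 8 * m * k.*2.
(** Here [l] bounds the number of remaining vertices, because all degrees sum to at most
    [k.*2 * #|T|]; the value is the error term of [sum_degree_few] for that many vertices. *)
Definition excess_bound (m : nat) : nat :=
  let l := medium_bound m * k.*2 in 2 ^ l * b.+1 * l.

(** With at most [b - 1] high vertices, the others in [L] lose a fraction [1/m] of their possible
    squared degree. This is a loss of about [N ^ 2 / m], which neither the excess in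
    [sum_degree_few] nor the vertices outside [L] can make up for. *)
Lemma card_high (m : nat) :
  0 < m -> 0 < b ->
  4 * m * (b + excess_bound m) + 4 < #|T| ->
  b * #|T|.-1 ^ 2 <= \sum_x degree G x ^ 2 -> b <= #|high m|.
Proof.
move=> m_gt0 b_gt0 nlarge sumd2; rewrite leqNgt; apply/negP => hi_small.
set K := excess_bound m in nlarge.
pose M := medium_bound m.
pose L := [set x | #|T| <= M * degree G x].
set n := #|T| in nlarge sumd2 L *.
set N := n.-1 in sumd2.
have M_gt0 : 0 < M by rewrite /M /medium_bound; lia.
have cL : #|L| <= M * k.*2.
  have : #|L| * n <= M * k.*2 * n.
    rewrite -sum_nat_const -mulnA.
    apply: (@leq_trans (M * \sum_x degree G x)); last first.
      by rewrite leq_mul2l sum_degree orbT.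
    rewrite big_distrr /= [X in _ <= X](bigID (mem L)) /=.
    apply: leq_trans (leq_addr _ _); apply: leq_sum => x; by rewrite inE.
  by rewrite leq_pmul2r //; lia.
have sumL : \sum_(x in L) degree G x <= b * n + K.
  apply: leq_trans (sum_degree_few L) _; rewrite leq_add2l /K /excess_bound -/M.
  by rewrite leq_mul // leq_mul // leq_exp2l.
have dN x : degree G x <= N by have := degree_lt x; rewrite /N /n; lia.
have sumH : \sum_(x in high m) degree G x <= b.-1 * N.
  apply: (@leq_trans (\sum_(x in high m) N)); first exact: leq_sum.
  by rewrite sum_nat_const leq_mul2r; apply/orP; right; lia.
(* Termwise: [m * d ^ 2 <= N * (m.-1 * d)] for a vertex that is not high, and a high vertex needs
   one more [N * d]. *)
have d2L : m * \sum_(x in L) degree G x ^ 2 <=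
    N * (m.-1 * (b * n + K) + b.-1 * N).
  apply: (@leq_trans (N * (m.-1 * \sum_(x in L) degree G x +
                           \sum_(x in high m) degree G x))); last first.
    by rewrite leq_mul2l leq_add ?orbT // leq_mul2l sumL orbT.
  rewrite [X in _ + X]big_mkcond /= [X in _ + X](bigID (mem L)) /=.
  rewrite addnA mulnDr; apply: leq_trans (leq_addr _ _).
  rewrite [m.-1 * _]big_distrr -big_split /= !big_distrr /=.
  apply: leq_sum => x _; have := dN x; rewrite !expnS expn0 muln1.
  have [_|] := boolP (x \in high m); last rewrite inE -ltnNge -/n -/N.
    move: (degree G x) => d dN'; rewrite -mulSnr (prednK m_gt0) mulnCA.
    by rewrite leq_mul2r dN' orbT.
  move: (degree G x) => d; rewrite addn0 => h dN'.
  by rewrite !mulnA leq_mul2r [N * _]mulnC (ltnW h) orbT.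
have d2S : M * \sum_(x in ~: L) degree G x ^ 2 <= n * (k.*2 * n).
  apply: (@leq_trans (n * \sum_x degree G x)); last first.
    by rewrite leq_mul2l sum_degree orbT.
  rewrite [X in _ <= _ * X](bigID (mem L)) /= mulnDr.
  apply: leq_trans (leq_addl _ _); rewrite !big_distrr /=.
  rewrite (eq_bigl (fun x => x \notin L)) => [|x]; last by rewrite inE.
  apply: leq_sum => x; rewrite inE -ltnNge expnS expn1 mulnA => /ltnW.
  by move=> h; rewrite leq_mul2r h orbT.
have {}sumd2 : m * (b * N ^ 2) <= N * (m.-1 * (b * n + K) + b.-1 * N)
    + m * \sum_(x in ~: L) degree G x ^ 2.
  apply: leq_trans (leq_add d2L (leqnn _)); rewrite -mulnDr leq_mul2l.
  apply/orP; right; apply: leq_trans sumd2 _; apply: eq_leq.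
  rewrite (bigID (mem L)) /=; congr (_ + _); apply: eq_bigl => x; by rewrite in_setC.
move: (\sum_(x in ~: L) degree G x ^ 2) d2S sumd2 => S d2S sumd2.
have {}d2S : 8 * m * S <= n ^ 2.
  have : k.*2 * (8 * m * S) <= k.*2 * n ^ 2.
    by move: d2S; rewrite /M /medium_bound !expnS expn0; lia.
  by rewrite leq_pmul2l //; lia.
have nN : n = N.+1 by rewrite /N; lia.
rewrite nN in nlarge d2S sumd2.
clear -m_gt0 b_gt0 nlarge d2S sumd2; move: N K nlarge d2S sumd2 => N K.
rewrite !expnS !expn0 !muln1.
case: m m_gt0 => // m _; case: b b_gt0 => // b' _ /= nlarge d2S sumd2.
(* After cancellation [N ^ 2] is bounded by two errors: [h1] makes the first at most [N ^ 2 / 4],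
   and [h2] with [d2S] makes the second at most [N ^ 2 / 2]. Everything is scaled by 8 to avoid
   division. *)
have h1 : 4 * (m * (b'.+1 + K)) <= N by lia.
have h2 : N.+1 * N.+1 <= 4 * (N * N) by nia.
have h3 : 0 < N * N by rewrite muln_gt0; lia.
have h4 : 8 * (N * N) <= 2 * (N * (4 * (m * (b'.+1 + K)))) + 8 * m.+1 * S by lia.
have h5 : N * (4 * (m * (b'.+1 + K))) <= N * N by rewrite leq_mul2l h1 orbT.
lia.
Qed.

End HighDegrees.

(** * Structure of the graph around a hub [B] *)

Section HubStructure.
Variables (T : finType) (G : sgraph T) (k b : nat).
Hypothesis k_def : k = b.*2 + 2 + odd k.
Hypothesis Pk_free : ~~ contains (path_graph k) G.
Variable B : {set T}.
Hypothesis b_gt0 : 0 < b.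
Hypothesis cardB : #|B| = b.

Definition joined : {set T} := [set w | [forall v in B, edge G v w]].
Definition rest : {set T} := ~: (B :|: joined).
Definition exits : {set T} := [set w in joined | [exists y in ~: B, edge G w y]].

Let k_gt0 : 0 < k. Proof. by rewrite k_def; lia. Qed.

Lemma joined_edge v w : v \in B -> w \in joined -> edge G v w.
Proof. by move=> vB; rewrite inE => /forall_inP; apply. Qed.

Lemma joined_notin w : w \in joined -> w \notin B.
Proof. by move=> wW; apply/negP => /joined_edge/(_ wW); rewrite edge_irr. Qed.

Hypothesis cardW : b + 3 <= #|joined|.

Lemma joined_avoid (l : seq T) : size l <= 3 -> exists2 w, w \in joined & w \notin l.
Proof.
move=> szl; have : ~~ (joined \subset [set x in l]).
  apply/negP => /subset_leq_card; rewrite [X in _ <= X]cardsE => h.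
  by have := leq_trans h (card_size l); lia.
by case/subsetPn => w wW; rewrite inE => wl; exists w.
Qed.

(** The path has [2b + 1] vertices besides [s] and [s'], so reaching [k] requires more than [odd k]
    extra ones. At most two extra vertices are allowed, which is what [cardW] leaves room for. *)
Lemma no_alternating_path (s s' : seq T) (x x' : T) :
  x \in joined -> x' \in joined ->
  path (edge G) x s -> path (edge G) x' s' ->
  uniq (x :: s ++ x' :: s') -> {in s ++ s', forall y, y \notin B} ->
  odd k < size s + size s' <= 2 -> False.
Proof.
move=> xW x'W ps ps' us sB szs.
have eWb : {in joined & enum B, forall w v, edge G w v}.
  by move=> w v wW; rewrite mem_enum edge_sym => vB; apply: joined_edge.
have [|||q uq [sq szq]] :=
  alternating_path _ eWb xW x'W ps ps' (enum_uniq _) us.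
- by rewrite -cardE cardB.
- by apply/hasPn => y /sB; rewrite /= mem_enum.
- by rewrite -cardE cardB; lia.
apply: (no_long_path k_gt0 Pk_free uq sq).
by rewrite szq -cardE cardB k_def; lia.
Qed.

(** For even [k] a single edge leaving [joined] outside [B] already prolongs the alternating path to
    [2b + 2 = k] vertices. *)
Lemma exits_even : ~~ odd k -> exits = set0.
Proof.
move=> k_even; apply/setP => x; rewrite in_set0; apply/negP.
rewrite inE => /andP[xW /exists_inP[y]]; rewrite inE => yB exy.
have [x' x'W] := @joined_avoid [:: x; y] isT; rewrite !inE negb_or => /andP[x'x x'y].
have yx : y != x by apply: contraTneq exy => ->; rewrite edge_irr.
apply: (@no_alternating_path [:: y] [::] x x') => //=.
- by rewrite exy.
- by rewrite !inE !negb_or eq_sym yx eq_sym x'x eq_sym x'y.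
- by move=> z; rewrite inE => /eqP->.
- by rewrite (negbTE k_even).
Qed.

(** Both extra vertices are attached at one end, which suffices for either parity of [k]. *)
Lemma no_joined_P3 x y z : x \in joined -> y \notin B -> z \notin B ->
  edge G x y -> edge G y z -> z != x -> False.
Proof.
move=> xW yB zB exy eyz zx.
have [x' x'W] := @joined_avoid [:: x; y; z] isT.
rewrite !inE !negb_or => /and3P[x'x x'y x'z].
have yx : y != x by apply: contraTneq exy => ->; rewrite edge_irr.
have zy : z != y by apply: contraTneq eyz => ->; rewrite edge_irr.
apply: (@no_alternating_path [:: y; z] [::] x x') => //=.
- by rewrite exy eyz.
- rewrite !inE !negb_or !(eq_sym x) yx zx x'x /= !(eq_sym y) zy x'y /=.
  by rewrite eq_sym x'z.
- by move=> u; rewrite !inE => /orP[]/eqP->.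
- by case: odd.
Qed.

(** One extra vertex is attached at each end. *)
Lemma no_joined_2K2 x y x' y' : x \in joined -> x' \in joined ->
  y \notin B -> y' \notin B -> edge G x y -> edge G x' y' ->
  uniq [:: x; y; x'; y'] -> False.
Proof.
move=> xW x'W yB y'B exy exy' u.
apply: (@no_alternating_path [:: y] [:: y'] x x') => //=.
- by rewrite exy.
- by rewrite exy'.
- by move=> z; rewrite !inE => /orP[]/eqP->.
- by case: odd.
Qed.

Lemma exitsP x :
  reflect (x \in joined /\ exists2 y, y \notin B & edge G x y) (x \in exits).
Proof.
rewrite [x \in exits]inE; apply: (iffP andP) => -[xW].
  by move=> /exists_inP[y]; rewrite inE => yB exy; split=> //; exists y.
by case=> y yB exy; split=> //; apply/exists_inP; exists y; rewrite ?inE.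
Qed.

(** If [x] and [y] are not adjacent, their neighbours outside [B] are new vertices: a common one
    gives a two-edge path, different ones give two disjoint edges. *)
Lemma exits_edge x y : x \in exits -> y \in exits -> x != y -> edge G x y.
Proof.
move=> /exitsP[xW [x' x'B ex]] /exitsP[yW [y' y'B ey]] xy.
apply: contraT => nexy.
have xx' : x != x' by apply: contraTneq ex => ->; rewrite edge_irr.
have yy' : y != y' by apply: contraTneq ey => ->; rewrite edge_irr.
have x'y : x' != y by apply: contraNneq nexy => <-.
have xy' : x != y' by apply: contraNneq nexy => ->; rewrite edge_sym.
have [x'y'|x'y'] := eqVneq x' y'.
  case: (@no_joined_P3 x x' y) => //; rewrite ?joined_notin // 1?eq_sym //.
  by rewrite edge_sym x'y'.
case: (@no_joined_2K2 x x' y y') => //=.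
by rewrite !inE !negb_or xx' xy xy' x'y x'y' yy'.
Qed.

(** Three exits would form a triangle outside [B], which contains a forbidden two-edge path. *)
Lemma card_exits : #|exits| <= 2.
Proof.
rewrite leqNgt; apply/negP => /card_gt2P[x [y [z [[xX yX zX] [xy yz zx]]]]].
have notB u : u \in exits -> u \notin B by case/exitsP => /joined_notin.
apply: (@no_joined_P3 x y z); rewrite ?notB ?exits_edge //.
by case/exitsP: xX.
Qed.

Lemma joined_nbr x y : x \notin B -> y \in joined -> edge G x y -> y \in exits.
Proof.
by move=> xB yW exy; apply/exitsP; split=> //; exists x; rewrite // edge_sym.
Qed.

Lemma degree_joined x : x \in joined :\: exits -> degree G x <= b.
Proof.
rewrite inE => /andP[xX xW]; rewrite -cardB; apply: subset_leq_card.
apply/subsetP => y; rewrite inE => exy; apply: contraNT xX => yB.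
by apply/exitsP; split=> //; exists y.
Qed.

(** A neighbour lies in [B], in [rest] or in [joined]; in the last case it is an exit, and there are
    at most two. *)
Lemma degree_outside x : x \notin B -> degree G x <= b + deg_in G rest x + 2.
Proof.
move=> xB; apply: (@leq_trans #|(B :|: [set y in rest | edge G x y]) :|: exits|).
  apply: subset_leq_card; apply/subsetP => y; rewrite inE => exy.
  rewrite 2!in_setU; have [//|yB] := boolP (y \in B).
  have [yW|yW] := boolP (y \in joined); first by rewrite (joined_nbr xB yW exy) orbT.
  by rewrite in_set exy andbT in_setC in_setU negb_or yB yW.
apply: leq_trans (leq_card_setU _ _) _; apply: leq_add card_exits.
by apply: leq_trans (leq_card_setU _ _) _; rewrite cardB.
Qed.

(** Each vertex of [rest] has a non-neighbour in [B]; the non-edges between the two sets are then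
    counted from the side of [B]. *)
Lemma card_rest : #|rest| <= \sum_(v in B) (#|T|.-1 - degree G v).
Proof.
apply: (@leq_trans (\sum_(y in rest) #|[set v in B | ~~ edge G v y]|)).
  rewrite -sum1_card; apply: leq_sum => y; rewrite in_setC in_setU negb_or.
  case/andP => yB; rewrite inE negb_forall_in => /exists_inP[v vB nvy].
  by rewrite card_gt0; apply/set0Pn; exists v; rewrite inE vB.
rewrite (sum_cards_incidence (fun y v => ~~ edge G v y)); apply: leq_sum => v vB.
have : #|[set y in rest | ~~ edge G v y] :|: [set y | edge G v y]| <= #|[set~ v]|.
  apply: subset_leq_card; apply/subsetP => y; rewrite in_setC1 in_setU !inE.
  apply: contraTneq => ->; by rewrite vB edge_irr.
rewrite cardsC1 cardsU (_ : _ :&: _ = set0) ?cards0; last first.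
  by apply/setP => y; rewrite !inE; case: edge; rewrite ?andbF.
by clear; rewrite /degree; lia.
Qed.

Lemma sum_hub_split (F : T -> nat) :
  \sum_x F x = \sum_(x in B) F x + \sum_(x in rest) F x
             + \sum_(x in exits) F x + \sum_(x in joined :\: exits) F x.
Proof.
rewrite (bigID (mem B)) /= -!addnA; congr (_ + _).
rewrite (bigID (mem rest)) /=; congr (_ + _).
  by apply: eq_bigl => x; rewrite in_setC in_setU; case: (x \in B).
rewrite (bigID (mem exits)) /=; congr (_ + _); apply: eq_bigl => x.
  rewrite in_setC in_setU negbK.
  have [/exitsP[xW _]|] := boolP (x \in exits); rewrite ?andbF // andbT.
  by rewrite (negbTE (joined_notin xW)) xW.
rewrite in_setC in_setU negbK in_setD.
have [xW|_] := boolP (x \in joined); last by case: (x \in B); rewrite ?andbF.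
by rewrite (negbTE (joined_notin xW)) andbT.
Qed.

(* With D the largest possible degree outside B, [rest] and [exits] contribute at
   most D^(p-1) (3b + 2k + 8) per vertex of [rest]. *)
Lemma power_sum_rest (p : nat) :
  1 < p -> 0 < #|rest| ->
  (b + #|rest| + 2) * (3 * b + k.*2 + 8) < #|T|.-1 ->
  e_ p G < b * #|T|.-1 ^ p + (#|T| - b) * b ^ p.
Proof.
case: p => // q; rewrite ltnS => q_gt0 r_gt0.
set N := #|T|.-1; set r := #|rest| in r_gt0 *; set D := b + r + 2.
set Q := 3 * b + k.*2 + 8 => DQ.
have dN x : degree G x <= N by have := degree_lt G x; rewrite /N; lia.
have dD x : x \notin B -> degree G x <= D.
  move=> xB; apply: leq_trans (degree_outside xB) _; rewrite leq_add2r leq_add2l.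
  by apply: subset_leq_card; apply/subsetP => y; rewrite inE => /andP[].
have XB x : x \in exits -> x \notin B by case/exitsP => /joined_notin.
have RB x : x \in rest -> x \notin B by rewrite in_setC in_setU negb_or => /andP[].
(* A vertex of [B] of degree [d] falls short of [N ^ q.+1] by at least [(N - d) * N ^ q], and by
   [card_rest] the defects [N - d] add up to at least [r]. *)
have sB : \sum_(x in B) degree G x ^ q.+1 + r * N ^ q <= b * N ^ q.+1.
  apply: (@leq_trans (\sum_(x in B) (degree G x * N ^ q + (N - degree G x) * N ^ q))).
    rewrite big_split /= -[X in _ <= _ + X]big_distrl /= leq_add //.
      by apply: leq_sum => x _; rewrite expnS leq_mul2l leq_exp2r // dN orbT.
    by rewrite leq_mul2r card_rest orbT.
  rewrite -cardB -sum_nat_const; apply: leq_sum => x _.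
  by rewrite -mulnDl subnKC ?dN // expnS.
have sR : \sum_(x in rest) degree G x ^ q.+1 <= D ^ q * ((b + k.*2 + 2) * r).
  apply: (@leq_trans (\sum_(x in rest) D ^ q * (b + deg_in G rest x + 2))).
    apply: leq_sum => x /RB xB; rewrite expnS mulnC leq_mul ?leq_exp2r ?dD //.
    exact: degree_outside.
  rewrite -big_distrr leq_mul2l /=; apply/orP; right.
  rewrite !big_split /= !sum_nat_const -/r.
  by have := sum_deg_in k_gt0 Pk_free rest; rewrite -/r; lia.
have sX : \sum_(x in exits) degree G x ^ q.+1 <= D ^ q * ((2 * b + 6) * r).
  apply: (@leq_trans (\sum_(x in exits) D ^ q.+1)).
    by apply: leq_sum => x /XB xB; rewrite leq_exp2r ?dD.
  rewrite sum_nat_const expnS mulnA mulnC leq_mul2l; apply/orP; right.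
  (* The bound on the two exits is turned into a multiple of [r], which is possible since [r] is
     positive. *)
  apply: (@leq_trans (2 * D)); first by rewrite leq_mul2r card_exits orbT.
  rewrite /D; clear -r_gt0; move: r r_gt0 => {}r r_gt0.
  rewrite -(prednK r_gt0) mulnS mulnDl.
  by move: (2 * b * r.-1) => u; lia.
have sW : \sum_(x in joined :\: exits) degree G x ^ q.+1 <= (#|T| - b) * b ^ q.+1.
  apply: (@leq_trans (\sum_(x in joined :\: exits) b ^ q.+1)).
    by apply: leq_sum => x /degree_joined dx; rewrite leq_exp2r.
  rewrite sum_nat_const leq_mul2r; apply/orP; right.
  rewrite -cardB -(cardC (mem B)) addKn; apply: subset_leq_card.
  by apply/subsetP => x; rewrite in_setD => /andP[_ /joined_notin].
(* Since [q] is positive, [D ^ q * Q <= (D * Q) ^ q], and [D * Q < N] by hypothesis. *)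
have key : D ^ q * (Q * r) < r * N ^ q.
  rewrite mulnA mulnC ltn_pmul2l //; apply: (@leq_trans ((D * Q) ^ q).+1).
    rewrite ltnS expnMn leq_mul2l; apply/orP; right.
    by rewrite -{1}[Q]expn1 leq_pexp2l // /Q; lia.
  by rewrite ltn_exp2r.
rewrite /e_ sum_hub_split.
have sRX : \sum_(x in rest) degree G x ^ q.+1 + \sum_(x in exits) degree G x ^ q.+1
    < r * N ^ q.
  apply: leq_trans key; rewrite ltnS; apply: leq_trans (leq_add sR sX) _.
  by rewrite -mulnDr -mulnDl /Q; apply: leq_mul => //; apply: leq_mul => //; lia.
move: sB sRX sW; move: (\sum_(x in B) _) (\sum_(x in rest) _) => s1 s2.
move: (\sum_(x in exits) _) (\sum_(x in _ :\: _) _) => s3 s4.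
move: (r * _) (b * _) (_ * b ^ _) => a1 a2 a3; lia.
Qed.

End HubStructure.

(** * The graph [H(n, k)]: no [P_k], and a lower bound for its power sum *)

Lemma sizeB_def k : 4 <= k -> k = (sizeB k).*2 + 2 + odd k.
Proof. by rewrite /sizeB => k4; have := odd_double_half k; lia. Qed.

(* Each of [b + 1] disjoint pairs meeting [B] would give [b + 1] elements of [B]. *)
Lemma pair_avoiding_B (n k : nat) (g : nat -> 'I_n) (l : nat -> nat) :
  {in [pred m | m < k] &, injective g} ->
  (forall i, i <= sizeB k -> (l i).+1 < k) ->
  (forall i j, i < j -> (l i).+1 < l j) ->
  exists2 i, i <= sizeB k & ~~ inB k (g (l i)) && ~~ inB k (g (l i).+1).
Proof.
move=> g_inj lk lmon.
suff /existsP[i Hi] : [exists i : 'I_(sizeB k).+1,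
    ~~ inB k (g (l i)) && ~~ inB k (g (l i).+1)].
  by exists i; rewrite // -ltnS.
apply: contraT; rewrite negb_exists => /forallP all_meet.
pose c (i : 'I_(sizeB k).+1) := if inB k (g (l i)) then l i else (l i).+1.
have cl (i : 'I_(sizeB k).+1) : l i <= c i <= (l i).+1 by rewrite /c; case: ifP; lia.
have cB (i : 'I_(sizeB k).+1) : g (c i) < sizeB k.
  rewrite /c; case: ifPn => // nB; have := all_meet i; rewrite nB /=.
  by rewrite negbK.
have ck (i : 'I_(sizeB k).+1) : c i < k.
  by have := lk i (ltnSE (ltn_ord i)); have := cl i; lia.
pose h (i : 'I_(sizeB k).+1) : 'I_(sizeB k) := Ordinal (cB i).
have h_inj : injective h.
  move=> i j /(congr1 val)/= /val_inj/g_inj => /(_ (ck i) (ck j)) cij.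
  apply: val_inj => /=; have := cl i; have := cl j; rewrite cij.
  by case: (ltngtP i j) => // /lmon; lia.
by have := leq_card h h_inj; rewrite !card_ord ltnn.
Qed.

(** Among the path edges at positions [(2i, 2i + 1)] one avoids [B], so it is the extra edge and [k]
    is odd. The edges at positions [(2i + 1, 2i + 2)] yield another one, but an injective path
    cannot use the extra edge twice. *)
Lemma H_graph_free (n k : nat) : 4 <= k -> ~~ contains (path_graph k) (H_graph n k).
Proof.
move=> k4; apply/existsP => -[f /andP[/injectiveP f_inj /forallP f_edge]].
have kdef := sizeB_def k4.
have k_gt0 : 0 < k by lia.
pose o m : 'I_k := insubd (Ordinal k_gt0) m.
have oE m : m < k -> o m = m :> nat by move=> mk; rewrite val_insubd mk.
pose g m := f (o m).
have g_inj : {in [pred m | m < k] &, injective g}.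
  by move=> i j ik jk /f_inj/(congr1 val)/=; rewrite !oE.
have g_edge m : m.+1 < k -> H_rel k (g m) (g m.+1).
  move=> mk; have := forallP (f_edge (o m)) (o m.+1).
  rewrite !sgraph_ofE /path_rel !oE ?eqxx //; exact: ltnW.
have extra m : m.+1 < k -> ~~ inB k (g m) && ~~ inB k (g m.+1) ->
    odd k && (extra_edge k (g m) (g m.+1) || extra_edge k (g m.+1) (g m)).
  move=> mk /andP[n1 n2]; have := g_edge m mk.
  by rewrite /H_rel (negbTE n1) (negbTE n2) /= => /andP[_].
have [| |i ib Hi] := pair_avoiding_B (l := fun i => i.*2) g_inj.
- by move=> i; lia.
- by move=> i j; lia.
have /andP[k_odd Ei] := extra i.*2 ltac:(lia) Hi.
(* The last of these pairs ends at position [2b + 2], which is below [k] only because [k] is odd. *)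
have [| |j jb Hj] := pair_avoiding_B (l := fun i => i.*2.+1) g_inj.
- by move=> j; lia.
- by move=> a c; lia.
have /andP[_ Ej] := extra j.*2.+1 ltac:(lia) Hj.
have gE a c : a < k -> c < k -> g a = g c :> nat -> a = c.
  by move=> ak ck /val_inj/g_inj; apply.
move: Ei Ej; rewrite /extra_edge.
case/orP => /andP[/eqP e1 /eqP e2] /orP[] /andP[/eqP e3 /eqP e4].
- have := gE i.*2 j.*2.+1 ltac:(lia) ltac:(lia) ltac:(lia); lia.
- have := gE i.*2 j.*2.+2 ltac:(lia) ltac:(lia) ltac:(lia).
  have := gE i.*2.+1 j.*2.+1 ltac:(lia) ltac:(lia) ltac:(lia); lia.
- have := gE i.*2 j.*2.+2 ltac:(lia) ltac:(lia) ltac:(lia).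
  have := gE i.*2.+1 j.*2.+1 ltac:(lia) ltac:(lia) ltac:(lia); lia.
- have := gE i.*2 j.*2.+1 ltac:(lia) ltac:(lia) ltac:(lia); lia.
Qed.

Lemma card_inB (n k : nat) : sizeB k <= n -> #|[set i : 'I_n | inB k i]| = sizeB k.
Proof.
move=> bn; have w_inj : injective (widen_ord bn).
  by move=> i j /(congr1 val)/= /val_inj.
rewrite -[RHS]card_ord -(card_imset predT w_inj).
apply: eq_card => i; rewrite inE; apply/idP/imsetP => [iB|[j _ ->]]; last first.
  by rewrite /inB /=.
by exists (Ordinal iB) => //; apply: val_inj.
Qed.

(** The extra edge for odd [k] is neglected: this cruder value already exceeds the power sum of a
    graph with nonempty [rest]. *)
Lemma e_H_graph_ge (n k p : nat) : sizeB k <= n ->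
  sizeB k * n.-1 ^ p + (n - sizeB k) * sizeB k ^ p <= e_ p (H_graph n k).
Proof.
move=> bn; have cB := card_inB bn.
rewrite /e_ (bigID (mem [set i | inB k i])) /=; apply: leq_add.
  rewrite -{1}cB -sum_nat_const; apply: leq_sum => i; rewrite inE => iB.
  case: p => // p; rewrite leq_exp2r //.
  rewrite -[n in n.-1]card_ord -(cardsC1 i); apply: subset_leq_card.
  by apply/subsetP => j; rewrite !inE sgraph_ofE /H_rel iB eq_sym => ->.
have -> : n - sizeB k = #|[predC [set i : 'I_n | inB k i]]|.
  by rewrite -cB -[n in n - _](card_ord n) -(cardC (mem [set i : 'I_n | inB k i])) addKn.
rewrite -sum_nat_const; apply: leq_sum => i; rewrite !inE => iB.
case: p => // p; rewrite leq_exp2r // -cB; apply: subset_leq_card.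
apply/subsetP => j; rewrite !inE sgraph_ofE /H_rel => jB; rewrite jB orbT andbT.
by apply: contraNneq iB => ->.
Qed.

(** * Isomorphisms and spanning subgraphs *)

Lemma degree_iso (T U : finType) (G : sgraph T) (H : sgraph U) (f : T -> U) :
  bijective f -> (forall x y, edge H (f x) (f y) = edge G x y) ->
  forall x, degree H (f x) = degree G x.
Proof.
move=> [g fK gK] fE x; rewrite /degree -(card_imset _ (can_inj fK)).
apply: eq_card => y; rewrite inE; apply/idP/imsetP => [exy|[z + ->]].
  by exists (g y); rewrite ?gK // inE -fE gK.
by rewrite inE -fE.
Qed.

Lemma e_iso (T U : finType) (G : sgraph T) (H : sgraph U) p :
  isomorphic G H -> e_ p G = e_ p H.
Proof.
case=> f f_bij fE; rewrite /e_ (reindex f) /=; last exact: onW_bij.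
by apply: eq_bigr => x _; rewrite (degree_iso f_bij fE).
Qed.

(** Degrees can only grow along [f], and one strict increase would make the power sum of [H] larger;
    so all degrees agree and no edge is added. *)
Lemma edge_homo_iso (T U : finType) (G : sgraph T) (H : sgraph U) (f : T -> U) p :
  0 < p -> bijective f -> (forall x y, edge G x y -> edge H (f x) (f y)) ->
  e_ p H <= e_ p G -> isomorphic G H.
Proof.
move=> p_gt0 f_bij f_homo leHG; exists f => //.
have f_inj := bij_inj f_bij.
have sub x : f @: [set y | edge G x y] \subset [set y | edge H (f x) y].
  by apply/subsetP => z /imsetP[y + ->]; rewrite !inE => /f_homo.
have dle x : degree G x <= degree H (f x).
  by rewrite /degree -(card_imset _ f_inj) subset_leq_card.
have deq x : degree G x = degree H (f x).
  apply/eqP; rewrite eqn_leq dle leqNgt; apply/negP => lt_d.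
  move: leHG; rewrite leqNgt => /negP; apply.
  rewrite /e_ [X in _ < X](reindex f) /=; last exact: onW_bij.
  rewrite (bigD1 x) //= [X in _ < X](bigD1 x) //= -addSn leq_add ?ltn_exp2r //.
  by apply: leq_sum => y _; rewrite leq_exp2r.
move=> x y; apply/idP/idP => [eH|]; last exact: f_homo.
have /eqP nbE : f @: [set y | edge G x y] == [set y | edge H (f x) y].
  by rewrite eqEcard sub card_imset //= -[X in _ <= X]/(degree G x) deq.
have : f y \in f @: [set y | edge G x y] by rewrite nbE inE.
by rewrite mem_imset // inE.
Qed.

(* The bijection lists [B], then the exits, then everything else. *)
Lemma hub_spanning_homo (n k : nat) (G : sgraph 'I_n) (B : {set 'I_n}) :
  4 <= k -> ~~ contains (path_graph k) G -> #|B| = sizeB k ->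
  sizeB k + 3 <= #|joined G B| -> rest G B = set0 ->
  exists2 f : 'I_n -> 'I_n, bijective f &
    forall x y, edge G x y -> edge (H_graph n k) (f x) (f y).
Proof.
move=> k4 free cB cW R0.
have kdef := sizeB_def k4.
have b_gt0 : 0 < sizeB k by rewrite /sizeB; lia.
set X := exits G B.
have inW x : x \notin B -> x \in joined G B.
  move=> xB; have : x \notin rest G B by rewrite R0 in_set0.
  by rewrite in_setC in_setU negbK (negbTE xB).
have inX x y : x \notin B -> y \notin B -> edge G x y -> x \in X.
  by move=> xB yB exy; apply/exitsP; split; [exact: inW | exists y].
have XB x : x \in X -> x \notin B by case/exitsP => /joined_notin.
pose l := enum B ++ enum X ++ enum (~: (B :|: X)).
have lT x : x \in l.
  rewrite !mem_cat !mem_enum in_setC in_setU.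
  by case: (x \in B); case: (x \in X).
have ul : uniq l.
  rewrite !cat_uniq !enum_uniq /= andbT; apply/andP; split; apply/hasPn => x.
    rewrite mem_cat !mem_enum => /orP[/XB//|].
    by rewrite in_setC in_setU negb_or => /andP[].
  by rewrite /= !mem_enum in_setC in_setU negb_or => /andP[].
have szl : size l = n.
  rewrite -[RHS]card_ord cardE; apply/perm_size/uniq_perm => //; first exact: enum_uniq.
  by move=> x; rewrite lT mem_enum.
have ltn x : index x l < n by rewrite -[X in _ < X]szl index_mem.
pose f x := Ordinal (ltn x).
have f_inj : injective f.
  move=> x y /(congr1 val)/= exy.
  by rewrite -(nth_index x (lT x)) exy nth_index.
exists f; first exact: injF_bij.
move=> x y exy; rewrite sgraph_ofE /H_rel.
have nxy : x != y by apply: contraTneq exy => ->; rewrite edge_irr.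
rewrite (inj_eq f_inj) nxy /=.
have fB z : z \in B -> inB k (f z).
  by move=> zB; rewrite /inB /= /l index_cat mem_enum zB -cB cardE index_mem mem_enum.
have [/fB->//|xB] := boolP (x \in B).
have [/fB->|yB] := boolP (y \in B); first by rewrite orbT.
have xX := inX _ _ xB yB exy.
have yX : y \in X by apply: (inX _ x); rewrite // edge_sym.
have k_odd : odd k.
  apply: contraT => k_even.
  by have := exits_even kdef free b_gt0 cB cW k_even => X0; rewrite /X X0 in_set0 in xX.
have cX : #|X| <= 2 := card_exits kdef free b_gt0 cB cW.
rewrite k_odd /= /extra_edge /=.
(* The exits follow [B] in [l], so two of them take the positions [sizeB k] and [(sizeB k).+1], the
   ends of the extra edge. *)
have fX z : z \in X -> index z l = sizeB k + index z (enum X).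
  move=> zX; rewrite /l index_cat mem_enum (negbTE (XB _ zX)) -cardE cB.
  by rewrite index_cat mem_enum zX.
rewrite !fX //.
have ix : index x (enum X) < 2 by apply: leq_trans cX; rewrite cardE index_mem mem_enum.
have iy : index y (enum X) < 2 by apply: leq_trans cX; rewrite cardE index_mem mem_enum.
have : index x (enum X) != index y (enum X).
  apply: contraNneq nxy => ixy.
  by rewrite -(nth_index x (_ : x \in enum X)) ?mem_enum // ixy nth_index ?mem_enum.
move: ix iy; move: (index x _) (index y _) => a c.
by case: a c => [|[|a]] [|[|c]] // _ _ _; rewrite ?addn0 ?addn1 !eqxx ?orbT.
Qed.

(** * Constants and the extremal theorem *)

(** The factor required by [power_sum_rest]. *)
Definition hub_slack (k : nat) : nat := 3 * sizeB k + k.*2 + 8.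
(** With this [m], a hub of [sizeB k] vertices from [high] has total defect at most
    [n.-1 / (2 * hub_slack k)], which bounds [rest]. *)
Definition hub_precision (k : nat) : nat := 2 * sizeB k * hub_slack k.
(** The first two summands serve [card_high], the last one [power_sum_rest]. *)
Definition threshold (k : nat) : nat :=
  let m := hub_precision k in let b := sizeB k in
  4 * m * (b + excess_bound k b m) + 4 + 2 * (b + 2) * hub_slack k.

(** Assuming only an inequality between the power sums lets this yield both the value of [t_] and
    uniqueness. *)
Lemma extremal_isomorphic (k p n : nat) (G : sgraph 'I_n) :
  4 <= k -> 2 <= p -> threshold k < n -> ~~ contains (path_graph k) G ->
  e_ p (H_graph n k) <= e_ p G -> isomorphic G (H_graph n k).
Proof.
move=> k4 p2 n_large free leHG.
have kdef := sizeB_def k4.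
have b_gt0 : 0 < sizeB k by rewrite /sizeB; lia.
have k_gt0 : 0 < k by lia.
set b := sizeB k in kdef b_gt0; set m := hub_precision k; set Q := hub_slack k.
have Q8 : 8 <= Q by rewrite /Q /hub_slack; lia.
have m_gt0 : 0 < m by rewrite /m /hub_precision -/Q -/b !muln_gt0 /= b_gt0; lia.
have [nl1 nl2] : 4 * m * (b + excess_bound k b m) + 4 < n /\ 2 * (b + 2) * Q < n.-1.
  move: n_large; rewrite /threshold -/b -/m -/Q.
  by move: (4 * m * _) (2 * (b + 2) * Q) => u v; lia.
have bn : 4 * b + 16 <= n.-1.
  apply: leq_trans (ltnW nl2); apply: (@leq_trans (2 * (b + 2) * 8)); first lia.
  by rewrite leq_mul2l Q8 orbT.
have geH := e_H_graph_ge p (_ : sizeB k <= n); rewrite -/b in geH.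
have {}geH := leq_trans (geH ltac:(lia)) leHG.
have dN x : degree G x <= n.-1 by have := degree_lt G x; rewrite card_ord; lia.
have sum2 : b * #|'I_n|.-1 ^ 2 <= \sum_x degree G x ^ 2.
  rewrite card_ord.
  have : b * n.-1 ^ p <= n.-1 ^ (p - 2) * \sum_x degree G x ^ 2.
    apply: leq_trans (leq_addr _ _) (leq_trans geH _).
    rewrite big_distrr /=; apply: leq_sum => x _.
    rewrite -[in X in X <= _](subnK p2) expnD leq_mul2r.
    case: (p - 2) => [|q]; first by rewrite !expn0 orbT.
    by rewrite leq_exp2r // dN orbT.
  rewrite -[in X in X <= _](subnK p2) expnD mulnCA leq_pmul2l // expn_gt0; lia.
have hi_large : b <= #|high G m|.
  apply: (card_high k_gt0 _ free m_gt0 b_gt0 _ sum2); last by rewrite card_ord.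
  by rewrite {1}kdef; case: odd; lia.
have /card_geqP[s [us szs s_hi]] := hi_large.
pose B := [set x in s].
have cB : #|B| = b by rewrite cardsE (card_uniqP us).
set r := #|rest G B|.
(* Membership in [high] means [m * (n.-1 - d) <= n.-1]; summing over [B] gives [m * r <= b * n.-1],
   where [m = 2 * b * Q]. *)
have r_small : 2 * Q * r <= n.-1.
  have : b * (2 * Q * r) <= b * n.-1.
    apply: (@leq_trans (m * \sum_(v in B) (n.-1 - degree G v))).
      have := card_rest G B; rewrite card_ord -/r => hr.
      have -> : b * (2 * Q * r) = m * r by rewrite /m /hub_precision -/b -/Q; lia.
      by rewrite leq_mul2l hr orbT.
    rewrite big_distrr /= -cB -sum_nat_const; apply: leq_sum => v; rewrite inE => /s_hi.
    rewrite inE card_ord mulnBr leq_subLR => hv.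
    by rewrite -{1}(prednK m_gt0) mulSn addnC leq_add2r.
  by rewrite leq_pmul2l.
have r_small16 : 16 * r <= n.-1.
  by apply: leq_trans r_small; rewrite leq_mul2r; apply/orP; right; lia.
have cW : b + 3 <= #|joined G B|.
  have := cardsC (B :|: joined G B); rewrite card_ord -/(rest G B) -/r.
  by have := leq_of_leqif (leq_card_setU B (joined G B)); rewrite cB; lia.
have [/eqP R0|R_gt0] := posnP r.
  have [|f f_bij f_homo] := hub_spanning_homo k4 free cB cW.
    by apply/eqP; rewrite -cards_eq0.
  by apply: edge_homo_iso f_bij f_homo leHG; lia.
(* Half of [n.-1] is reserved for [(b + 2) * Q] by the threshold, the other half for [r * Q] by
   [r_small]. *)
have DQ : (b + r + 2) * Q < #|'I_n|.-1.
  rewrite card_ord; have -> : (b + r + 2) * Q = (b + 2) * Q + r * Q by lia.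
  have h1 : 2 * ((b + 2) * Q) < n.-1 by rewrite mulnA.
  have h2 : 2 * (r * Q) <= n.-1 by rewrite [r * Q]mulnC mulnA.
  by move: ((b + 2) * Q) (r * Q) h1 h2 => u v; lia.
have := power_sum_rest kdef free b_gt0 cB cW p2 R_gt0 DQ.
by rewrite card_ord ltnNge geH.
Qed.

Theorem theorem1p2 (k : nat) (hk : 4 <= k) :
  exists n0 : nat, forall p n : nat, 2 <= p -> n0 < n ->
    [/\ ~~ contains (path_graph k) (H_graph n k),
        t_ p n (path_graph k) = e_ p (H_graph n k) &
        forall G : sgraph 'I_n,
          ~~ contains (path_graph k) G ->
          e_ p G = t_ p n (path_graph k) ->
          isomorphic G (H_graph n k)].
Proof.
exists (threshold k) => p n p2 n_large.
have free := H_graph_free n hk.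
have tE : t_ p n (path_graph k) = e_ p (H_graph n k).
  apply/eqP; rewrite eqn_leq /t_; apply/andP; split; last exact: leq_bigmax_cond.
  apply/bigmax_leqP => G G_free; rewrite leqNgt; apply/negP => ltHG.
  have := e_iso p (extremal_isomorphic hk p2 n_large G_free (ltnW ltHG)).
  by move=> eGH; rewrite eGH ltnn in ltHG.
split=> // G G_free eG.
by apply: (extremal_isomorphic hk p2 n_large G_free); rewrite eG tE.
Qed.
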